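(* Let $q:\mathbb{C}^n\to\mathbb{C}$ be a holomorphic polynomial that does not vanish on the closed unit ball $\overline{B_n}$. Then there exist an integer $N$ and a holomorphic polynomial mapping $p:\mathbb{C}^n\to\mathbb{C}^N$ such that (1) $p/q$ is a rational proper holomorphic mapping from $B_n$ to $B_N$, and (2) $p/q$ is reduced to lowest terms (no non-constant polynomial divides both $q$ and all components of $p$).
   Context: $B_k$ denotes the open unit ball in $\mathbb{C}^k$. A holomorphic mapping $f:B_n\to B_N$ is proper if $f^{-1}(K)$ is compact in $B_n$ for every compact $K\subset B_N$. *)

(* Defs.v *)
From mathcomp Require Import all_boot all_algebra.
From mathcomp Require Import complex.
From mathcomp Require Import mpoly.
From mathcomp Require Import all_classical all_reals all_analysis.

Import numFieldNormedType.Exports.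
Import GRing.Theory Num.Theory.
Local Open Scope ring_scope.
Local Open Scope classical_set_scope.

Set Implicit Arguments.
Unset Strict Implicit.
Unset Printing Implicit Defensive.

(* the complex numbers, as a numFieldType (hence with its norm topology) *)
Definition Cplx (R : realType) : numFieldType := (R[i] : numFieldType).

Notation cpoly R n := (mpoly.mpoly n (Cplx R)).

Definition peval (R : realType) (n : nat) (p : cpoly R n) (z : 'rV[Cplx R]_n)
  : Cplx R := mpoly.meval (fun i => z ord0 i) p.

Definition sqnorm (R : realType) (n : nat) (z : 'rV[Cplx R]_n) : Cplx R :=
  \sum_(i < n) `|z ord0 i| ^+ 2.

Definition unit_ball (R : realType) (n : nat) : set 'rV[Cplx R]_n :=
  [set z | sqnorm z < 1].
Definition closed_unit_ball (R : realType) (n : nat) : set 'rV[Cplx R]_n :=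
  [set z | sqnorm z <= 1].

(* the rational map p/q : C^n -> C^N (meaningful where q <> 0) *)
Definition ratmap (R : realType) (n N : nat) (p : 'I_N -> cpoly R n)
  (q : cpoly R n) (z : 'rV[Cplx R]_n) : 'rV[Cplx R]_N :=
  \row_(j < N) (peval (p j) z / peval q z).

Definition maps_ball (R : realType) (n N : nat)
  (f : 'rV[Cplx R]_n -> 'rV[Cplx R]_N) : Prop :=
  forall z, @unit_ball R n z -> @unit_ball R N (f z).

Definition proper_ball_map (R : realType) (n N : nat)
  (f : 'rV[Cplx R]_n -> 'rV[Cplx R]_N) : Prop :=
  maps_ball f /\
  forall K : set 'rV[Cplx R]_N, K `<=` @unit_ball R N -> compact K ->
    compact (@unit_ball R n `&` f @^-1` K).

Definition pdivides (R : realType) (n : nat) (d p : cpoly R n) : Prop :=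
  exists r : cpoly R n, p = d * r.

(* non-constant polynomial: total degree >= 1 (msize = total degree + 1) *)
Definition nonconstant (R : realType) (n : nat) (d : cpoly R n) : Prop :=
  (1 < mpoly.msize d)%N.

Definition reduced (R : realType) (n N : nat) (p : 'I_N -> cpoly R n)
  (q : cpoly R n) : Prop :=
  forall d : cpoly R n, nonconstant d -> pdivides d q ->
    ~ (forall j, pdivides d (p j)).

(* Main.v *)
(* Call a real polynomial P in (z, conj z) good if there are holomorphic
   polynomials h_1, ..., h_k with sum |h_i|^2 <= P on the closed unit ball and
   equality on the sphere. The good polynomials form a semiring; it contains
   1 - |z|^2 (with k = 0), and
     2 + 2 Re (conj w z_j) >= |w + z_j|^2 + sum_(i != j) |z_i|^2   (|w| = 1)
   shows that it is Archimedean. By the Kadison-Dubois representation theorem,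
   a polynomial that is positive at every character nonnegative on the semiring
   stays good after subtracting some e > 0. Characters are evaluations at
   points, and since 1 - |z|^2 is good these lie in the closed ball, where
   |q|^2 > 0: so |q|^2 - e is good. With the corresponding h, the components
   h_i and sqrt e * z_j have squared length |q|^2 on the sphere and less than
   |q|^2 inside, with no appeal to the maximum principle. A common factor of q
   and sqrt e * z_1 would vanish at 0, where q does not. *)

Require Import Defs.
From mathcomp Require Import all_boot all_algebra.
From mathcomp Require Import all_order.
From mathcomp Require Import complex.
From mathcomp Require Import mpoly.
From mathcomp Require Import all_classical all_reals all_analysis.
From mathcomp Require Import ring lra.

Import numFieldNormedType.Exports.
Import Order.TTheory GRing.Theory Num.Theory.
Local Open Scope ring_scope.
Local Open Scope classical_set_scope.

Set Implicit Arguments.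
Unset Strict Implicit.
Unset Printing Implicit Defensive.

(** * The Kadison-Dubois theorem for Archimedean semirings *)

Section KadisonDubois.
Context {R : realType} {A : comNzRingType} (c : {rmorphism R -> A}).

Definition archimedean_semiring (T : set A) :=
  [/\ forall r, 0 <= r -> T (c r),
      forall a b, T a -> T b -> T (a + b),
      forall a b, T a -> T b -> T (a * b) &
      forall a, exists k, T (c k - a)].

Definition proper_module (T M : set A) :=
  [/\ forall a b, M a -> M b -> M (a + b),
      forall t a, T t -> M a -> M (t * a) & ~ M (- 1)].

Variables (T : set A) (HT : archimedean_semiring T).

Let Tc r : 0 <= r -> T (c r). Proof. by case: HT => + _ _ _; exact. Qed.
Let TD a b : T a -> T b -> T (a + b). Proof. by case: HT => _ + _ _; exact. Qed.
Let TM a b : T a -> T b -> T (a * b). Proof. by case: HT => _ _ + _; exact. Qed.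
Let Tbound a : exists k, T (c k - a). Proof. by case: HT => _ _ _; exact. Qed.
Let T0 : T 0. Proof. by rewrite -(rmorph0 c); exact: Tc. Qed.
Let T1 : T 1. Proof. by rewrite -(rmorph1 c); exact: Tc. Qed.

Lemma archimedean_bound a : exists2 k, 0 < k & T (c k - a).
Proof.
have [k Tk] := Tbound a.
exists (`|k| + 1); first by rewrite ltr_pwDr.
have -> : c (`|k| + 1) - a = c (`|k| + 1 - k) + (c k - a) by ring.
by apply: TD => //; apply: Tc; have := ler_norm k; lra.
Qed.

Lemma archimedean_diff a : exists t1 t2, [/\ T t1, T t2 & a = t1 - t2].
Proof.
have [k k0 Tk] := archimedean_bound a.
exists (c k), (c k - a); split=> //; first by apply: Tc; exact: ltW.
by ring.
Qed.

Lemma maximal_module (M0 : set A) : proper_module T M0 -> M0 !=set0 ->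
  exists M, [/\ M0 `<=` M, proper_module T M &
    forall M', M `<=` M' -> proper_module T M' -> M' `<=` M].
Proof.
move=> M0p M0n.
(* Zorn's lemma also tests the empty chain, whose union is empty; the guard lets the empty set pass.
   It cannot be maximal, since [M0] satisfies [P] as well. *)
pose P M := proper_module T M /\ (M !=set0 -> M0 `<=` M).
have [F FP Ftot|M [[Mp M0M] Mmax]] := @Zorn_bigcup A P.
  split; last first.
    move=> [a [M FM Ma]] b M0b; exists M => //.
    by case: (FP _ FM) => _ /(_ (ex_intro _ a Ma)); exact.
  split.
  - move=> a b [M1 F1 M1a] [M2 F2 M2b].
    have [M12|M21] := Ftot _ _ F1 F2.
      by exists M2 => //; case: (FP _ F2) => -[+ _ _] _; apply=> //; exact: M12.
    by exists M1 => //; case: (FP _ F1) => -[+ _ _] _; apply=> //; exact: M21.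
  - by move=> t a Tt [M FM Ma]; exists M => //; have [[_ MT _] _] := FP _ FM; exact: MT.
  - by move=> [M FM Ma]; have [[_ _ MN] _] := FP _ FM; exact: MN.
have Mn : M !=set0.
  apply/set0P/negP => /eqP Me; apply: (Mmax M0); last by split=> // _; exact: subset_refl.
  by rewrite Me; split; [exact: sub0set|case: M0n => x M0x /(_ x M0x)].
exists M; split=> [|//|M' MM' M'p]; first exact: M0M.
apply: contrapT => M'M; apply: (Mmax M'); first by split.
by split=> // _; apply: (subset_trans _ MM'); exact: M0M.
Qed.

(** * Maximal modules and the characters they define *)

Section MaximalModule.
Variables (M : set A) (Mp : proper_module T M) (TM_sub : T `<=` M).
Hypothesis Mmax : forall M', M `<=` M' -> proper_module T M' -> M' `<=` M.

Let MD a b : M a -> M b -> M (a + b). Proof. by case: Mp => + _ _; exact. Qed.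
Let MM t a : T t -> M a -> M (t * a). Proof. by case: Mp => _ + _; exact. Qed.
Let MN1 : ~ M (- 1). Proof. by case: Mp. Qed.

Lemma module_const_ge0 r : M (c r) -> 0 <= r.
Proof.
move=> Mr; rewrite leNgt; apply/negP => r0; apply: MN1.
have -> : -1 = c (- r^-1) * c r by rewrite -rmorphM mulNr mulVf ?lt_eqF// rmorphN1.
by apply: MM => //; apply: Tc; rewrite oppr_ge0 invr_le0 ltW.
Qed.

Lemma maximal_module_total a : M a \/ M (- a).
Proof.
(* If [x] is outside [M], the larger module M + xT cannot be proper, by maximality, so it contains
   -1. *)
have witness x : ~ M x -> exists m t, [/\ M m, T t & -1 = m + x * t].
  move=> Mx; pose M' := [set y | exists m t, [/\ M m, T t & y = m + x * t]].
  apply: contrapT => nex; apply: Mx; apply: (Mmax (M' := M')).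
  - by move=> y My; exists y, 0; split=> //; ring.
  - split=> //.
    + move=> _ _ [m [t [Mm Tt ->]]] [m' [t' [Mm' Tt' ->]]].
      by exists (m + m'), (t + t'); split; [exact: MD|exact: TD|ring].
    + move=> s _ Ts [m [t [Mm Tt ->]]].
      by exists (s * m), (s * t); split; [exact: MM|exact: TM|ring].
  - by exists 0, 1; split=> //; [exact: TM_sub|ring].
(* If both a and -a failed, both would be inverted into -1; eliminating a gives
   -t1 in M, so t1, hence a * t1, lies in the ideal M /\ -M. *)
have [|Ma] := pselect (M a); [by left|right].
apply: contrapT => MNa.
have [m1 [t1 [Mm1 Tt1 E1]]] := witness _ Ma.
have [m2 [t2 [Mm2 Tt2 E2]]] := witness _ MNa.
have MNt1 : M (- t1).
  have -> : - t1 = t2 + (t2 * m1 + t1 * m2).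
    have -> : m1 = -1 - a * t1 by rewrite E1; ring.
    have -> : m2 = -1 + a * t2 by rewrite E2; ring.
    by ring.
  by apply: MD; [exact: TM_sub|apply: MD; exact: MM].
apply: MN1; rewrite E1; apply: MD => //.
have [s1 [s2 [Ts1 Ts2 ->]]] := archimedean_diff a.
have -> : (s1 - s2) * t1 = s1 * t1 + s2 * (- t1) by ring.
by apply: MD; [apply: TM_sub; exact: TM|exact: MM].
Qed.

(** Members of [M] count as nonnegative; modulo this order [a] differs from the real [x] by an
    infinitesimal, so [x] is the value at [a] of the character to come. *)
Definition module_value a x :=
  forall e, 0 < e -> M (c e + (a - c x)) /\ M (c e - (a - c x)).

(** The value is a Dedekind cut: the supremum of the constants below [a], finite because [T] is
    Archimedean. *)
Lemma module_value_exists a : exists x, module_value a x.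
Proof.
have [k k0 Tk] := archimedean_bound a.
have [l l0 Tl] := archimedean_bound (- a).
pose E := [set r | M (a - c r)].
have Eub : ubound E k.
  move=> r Er; rewrite -subr_ge0; apply: module_const_ge0.
  by have -> : c (k - r) = (c k - a) + (a - c r) by [ring]; apply: MD => //; exact: TM_sub.
have Esup : has_sup E.
  split; last by exists k.
  by exists (- l); rewrite /E/=; have -> : a - c (- l) = c l - - a by [ring]; exact: TM_sub.
exists (sup E) => e e0; split.
  have [r Er] := sup_adherent e0 Esup; move=> ltr.
  have -> : c e + (a - c (sup E)) = c (e - sup E + r) + (a - c r) by ring.
  by apply: MD => //; apply: TM_sub; apply: Tc; lra.
(* Were this element in [M], the supremum would be exceeded; totality then gives the opposite
   sign. *)
have [Mpos|] := maximal_module_total (a - c (sup E + e)); last first.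
  by have -> : - (a - c (sup E + e)) = c e - (a - c (sup E)) by ring.
by have := sup_upper_bound Esup Mpos; lra.
Qed.

Lemma module_value_le a b x y : module_value a x -> module_value b y ->
  M (b - a) -> x <= y.
Proof.
move=> ax by_ Mba; apply/ler_addgt0Pr => e e0.
have e20 : 0 < e / 2 by rewrite divr_gt0.
rewrite -subr_ge0; apply: module_const_ge0.
have -> : c (y + e - x) = (c (e / 2) + (a - c x)) + (b - a) + (c (e / 2) - (b - c y)).
  have {1}-> : e = e / 2 + e / 2 by field.
  by ring.
by apply: MD; [apply: MD => //; case: (ax _ e20)|case: (by_ _ e20)].
Qed.

Lemma module_value_uniq a x y : module_value a x -> module_value a y -> x = y.
Proof.
move=> ax ay; have Maa : M (a - a) by rewrite subrr; exact: TM_sub.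
by apply/eqP; rewrite eq_le (module_value_le ax ay)// (module_value_le ay ax).
Qed.

Lemma module_value_const r : module_value (c r) r.
Proof.
by move=> e e0; rewrite subrr addr0 subr0; split; apply/TM_sub/Tc; exact: ltW.
Qed.

Lemma module_valueD a b x y : module_value a x -> module_value b y ->
  module_value (a + b) (x + y).
Proof.
move=> ax by_ e e0; have e20 : 0 < e / 2 by rewrite divr_gt0.
have [? ?] := ax _ e20; have [? ?] := by_ _ e20.
have -> : c e = c (e / 2) + c (e / 2).
  by rewrite -rmorphD; congr (c _); field.
split.
  by have -> : c (e / 2) + c (e / 2) + (a + b - c (x + y)) =
    (c (e / 2) + (a - c x)) + (c (e / 2) + (b - c y)) by [ring]; exact: MD.
by have -> : c (e / 2) + c (e / 2) - (a + b - c (x + y)) =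
  (c (e / 2) - (a - c x)) + (c (e / 2) - (b - c y)) by [ring]; exact: MD.
Qed.

Lemma module_valueN a x : module_value a x -> module_value (- a) (- x).
Proof.
move=> ax e e0; have [? ?] := ax _ e0; split.
  by have -> : c e + (- a - c (- x)) = c e - (a - c x) by ring.
by have -> : c e - (- a - c (- x)) = c e + (a - c x) by ring.
Qed.

(** Infinitesimals form an ideal. Since [A] is T - T, a factor t in [T] is enough. If [k] bounds t,
    then e = (e/k)(k - t) + t(e/k), so e + at and e - at both lie in T + tM. *)
Lemma module_value0M a b : module_value a 0 -> module_value (a * b) 0.
Proof.
move=> a0; have [t1 [t2 [Tt1 Tt2 ->]]] := archimedean_diff b.
suff tv t : T t -> module_value (a * t) 0.
  have := module_valueD (tv _ Tt1) (module_valueN (tv _ Tt2)).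
  by rewrite oppr0 addr0 mulrBr.
move=> Tt e e0; have [k k0 Tk] := archimedean_bound t.
have ek0 : 0 < e / k by exact: divr_gt0.
have -> : c e = c (e / k) * (c k - t) + t * c (e / k).
  rewrite mulrBr (mulrC t) subrK -rmorphM divfK//; lra.
have Mr : M (c (e / k) * (c k - t)).
  by apply: TM_sub; apply: TM => //; apply: Tc; exact: ltW.
have [M1 M2] := a0 _ ek0; split.
  have -> : c (e / k) * (c k - t) + t * c (e / k) + (a * t - c 0) =
    c (e / k) * (c k - t) + t * (c (e / k) + (a - c 0)) by ring.
  by apply: MD => //; exact: MM.
have -> : c (e / k) * (c k - t) + t * c (e / k) - (a * t - c 0) =
  c (e / k) * (c k - t) + t * (c (e / k) - (a - c 0)) by ring.
by apply: MD => //; exact: MM.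
Qed.

Lemma module_valueM a b x y : module_value a x -> module_value b y ->
  module_value (a * b) (x * y).
Proof.
move=> ax by_.
have centre d z : module_value d z -> module_value (d - c z) 0.
  move=> dz; rewrite -(subrr z); apply: module_valueD => //.
  by rewrite -rmorphN; exact: module_value_const.
(* Uses ab - xy = (a - x) b + (b - y) x, a sum of two infinitesimals. *)
have := module_valueD (module_value0M b (centre _ _ ax))
  (module_value0M (c x) (centre _ _ by_)).
move=> /module_valueD/(_ (module_value_const (x * y))).
rewrite !add0r.
by have -> : (a - c x) * b + (b - c y) * c x + c (x * y) = a * b by ring.
Qed.

(** Values exist and are unique, so choosing them gives a function, and the rules for sums and
    products make it a homomorphism. *)
Lemma maximal_module_character : exists chi : A -> R,
  [/\ {morph chi : a b / a + b}, {morph chi : a b / a * b},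
      forall r, chi (c r) = r & forall a, M a -> 0 <= chi a].
Proof.
have [chi chiP] := choice module_value_exists.
exists chi; split.
- move=> a b; exact: (module_value_uniq (chiP _) (module_valueD (chiP _) (chiP _))).
- move=> a b; exact: (module_value_uniq (chiP _) (module_valueM (chiP _) (chiP _))).
- move=> r; exact: (module_value_uniq (chiP _) (module_value_const r)).
- move=> a Ma; apply: (module_value_le (module_value_const 0) (chiP a)).
  by rewrite rmorph0 subr0.
Qed.

End MaximalModule.

(* A lower bound r on f improves by 1/k, where k bounds t, by writing
   k (f + r - 1/k) = (k - t) (f + r) + (f t - 1) + t r. *)
Lemma archimedean_lower (f t : A) : T t -> T (f * t - 1) ->
  exists2 e, 0 < e & T (f - c e).
Proof.
move=> Tt Tft.
have [k k0 Tk] := archimedean_bound t.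
have step r : 0 <= r -> T (f + c r) -> T (f + c (r - k^-1)).
  move=> r0 Tf.
  have -> : f + c (r - k^-1) = c k^-1 * ((c k - t) * (f + c r) + (f * t - 1) + t * c r).
    have kk : c k^-1 * c k = 1 by rewrite -rmorphM mulVf ?gt_eqF// rmorph1.
    rewrite rmorphB/=.
    transitivity (c k^-1 * c k * (f + c r) - c k^-1); last by ring.
    by rewrite kk; ring.
  apply: TM; first by apply: Tc; rewrite invr_ge0 ltW.
  by apply: TD; [apply: TD => //; exact: TM|apply: TM => //; exact: Tc].
have [l l0 Tl] := archimedean_bound (- f).
(* Steps of size 1/k lead from j/k down to 0, and one more yields a strictly positive lower
   bound. *)
have steps j : T (f + c (j%:R / k)) -> T (f - c k^-1).
  elim: j => [|j IH]; first by move=> /step; rewrite mul0r sub0r rmorphN; exact.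
  move=> /step; rewrite divr_ge0 ?ler0n ?(ltW k0)// => /(_ isT).
  by rewrite -{2}(mul1r k^-1) -mulrBl -natr1 addrK; exact: IH.
exists k^-1; rewrite ?invr_gt0//.
(* [Num.bound (l * k)] exceeds lk, so the descent starts above [l], and f + l is already in [T]. *)
apply: (steps (Num.bound (l * k))).
have -> : f + c ((Num.bound (l * k))%:R / k) =
  c ((Num.bound (l * k))%:R / k - l) + (c l - - f).
  by ring.
apply: TD => //; apply: Tc.
rewrite subr_ge0 ler_pdivlMr//; apply/ltW.
by apply: archi_boundP; rewrite mulr_ge0// ltW.
Qed.

(** Consider the module T - fT. If it contains -1 = t1 - f t2, then f t2 - 1 is in [T] and
    [archimedean_lower] applies. Otherwise it extends to a maximal proper module, whose character is
    nonnegative on [T] and on -f, against the positivity of f. *)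
Lemma kadison_dubois (f : A) :
  (forall chi : A -> R, {morph chi : a b / a + b} -> {morph chi : a b / a * b} ->
     (forall r, chi (c r) = r) -> (forall a, T a -> 0 <= chi a) -> 0 < chi f) ->
  exists2 e, 0 < e & T (f - c e).
Proof.
move=> fpos.
pose M0 := [set y | exists t1 t2, [/\ T t1, T t2 & y = t1 - f * t2]].
have TM0 : T `<=` M0 by move=> t Tt; exists t, 0; split=> //; ring.
have [[t1 [t2 [Tt1 Tt2 E]]]|M0N1] := pselect (M0 (-1)).
  apply: (archimedean_lower Tt2); have -> // : f * t2 - 1 = t1.
  by rewrite E; ring.
have M0p : proper_module T M0.
  split=> //.
  - move=> _ _ [t [s [Tt Ts ->]]] [t' [s' [Tt' Ts' ->]]].
    by exists (t + t'), (s + s'); split; [exact: TD|exact: TD|ring].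
  - move=> u _ Tu [t [s [Tt Ts ->]]].
    by exists (u * t), (u * s); split; [exact: TM|exact: TM|ring].
have [|M [M0M Mp Mmax]] := maximal_module M0p; first by exists 0; exact: TM0.
have [chi [chiD chiM chic chi0]] :=
  maximal_module_character Mp (subset_trans TM0 M0M) Mmax.
have := fpos chi chiD chiM chic (fun a Ta => chi0 a (M0M _ (TM0 _ Ta))).
have : 0 <= chi (c (-1) * f).
  by apply/chi0/M0M; exists 0, 1; split=> //; rewrite rmorphN1; ring.
by rewrite chiM chic mulN1r; lra.
Qed.

End KadisonDubois.

(** Suits properties compatible with the ring operations, such as continuity, agreement of
    characters, or splitting into real and imaginary parts. *)
Lemma mpoly_ring_ind (n : nat) (K : comNzRingType) (P : {mpoly K[n]} -> Prop) :
  (forall a, P a%:MP) -> (forall i, P 'X_i) ->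
  (forall p q, P p -> P q -> P (p + q)) ->
  (forall p q, P p -> P q -> P (p * q)) -> forall p, P p.
Proof.
move=> PC PX PD PM; elim/mpolyind => [|a m p _ _ Pp]; first exact: (PC 0).
apply: PD => //; rewrite -mul_mpolyC; apply: (PM) => //.
rewrite mpolyXE_id; apply: big_ind; [exact: (PC 1)|exact: PM|move=> i _].
elim: (m i) => [|k IH]; first by rewrite expr0; exact: (PC 1).
by rewrite exprS; exact: PM.
Qed.

(** * Polynomials dominating sums of squared moduli on the ball *)

Section BallPositivity.
Context {R : realType} {n : nat}.
Implicit Types (z : 'rV[Cplx R]_n) (P : {mpoly R[n + n]}) (x y : Cplx R).

(** Takes values in [R], whereas the norm of [Cplx R] takes values in [Cplx R] itself. *)
Definition sqmod x : R := complex.Re x ^+ 2 + complex.Im x ^+ 2.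

Lemma sqr_norm_sqmod x : `|x| ^+ 2 = (sqmod x)%:C%C :> Cplx R.
Proof.
rewrite /Cplx/= normc_def -rmorphXn/= sqr_sqrtr//.
by rewrite addr_ge0// sqr_ge0.
Qed.

Lemma sqmod_ge0 x : 0 <= sqmod x.
Proof. by rewrite addr_ge0// sqr_ge0. Qed.

Lemma sqmodM x y : sqmod (x * y) = sqmod x * sqmod y.
Proof. by case: x => a b; case: y => u v; rewrite /sqmod/=; ring. Qed.

Lemma sqmodD x y :
  sqmod (x + y) = sqmod x + sqmod y
    + 2 * (complex.Re x * complex.Re y + complex.Im x * complex.Im y).
Proof. by case: x => a b; case: y => u v; rewrite /sqmod/=; ring. Qed.

Lemma sqmod_real (r : R) : sqmod (r%:C)%C = r ^+ 2.
Proof. by rewrite /sqmod/= expr0n addr0. Qed.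

Lemma sqmod_eq0 x : (sqmod x == 0) = (x == 0).
Proof. by case: x => a b; rewrite /sqmod paddr_eq0 ?sqr_ge0// !sqrf_eq0 eq_complex. Qed.

Definition sqlen z : R := \sum_(i < n) sqmod (z ord0 i).

Lemma sqnorm_sqlen z : sqnorm z = (sqlen z)%:C%C.
Proof. by rewrite /sqnorm /sqlen rmorph_sum; apply: eq_bigr => i _; exact: sqr_norm_sqmod. Qed.

Lemma closed_unit_ball_sqlen z : closed_unit_ball z <-> sqlen z <= 1.
Proof. by rewrite /closed_unit_ball/= sqnorm_sqlen -(rmorph1 (real_complex R)) lecR. Qed.

Lemma unit_ball_sqlen z : unit_ball z <-> sqlen z < 1.
Proof. by rewrite /unit_ball/= sqnorm_sqlen -(rmorph1 (real_complex R)) ltcR. Qed.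

Definition real_coord z (l : 'I_(n + n)) : R :=
  match fintype.split l with
  | inl j => complex.Re (z ord0 j)
  | inr j => complex.Im (z ord0 j)
  end.

(** Real polynomials in z and conj z are encoded through the 2n real coordinates, so that characters
    become points of C^n. *)
Definition reval P z : R := P.@[real_coord z].

Definition point_of (v : 'I_(n + n) -> R) : 'rV[Cplx R]_n :=
  \row_j ((v (lshift n j) +i* v (rshift n j))%C : Cplx R).

Lemma point_ofK v : real_coord (point_of v) =1 v.
Proof.
move=> l; rewrite /real_coord; have := splitK l.
by case: (fintype.split l) => j; rewrite /unsplit mxE /= => ->.
Qed.

Lemma cpoly_re_im (q : cpoly R n) : exists P Q,
  forall z, peval q z = (reval P z +i* reval Q z)%C.
Proof.
elim/mpoly_ring_ind: q => [[a b]|i|p q [P [Q E]] [P' [Q' E']]|p q [P [Q E]] [P' [Q' E']]].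
- by exists a%:MP, b%:MP => z; rewrite /peval /reval !mevalC.
- exists 'X_(lshift n i), 'X_(rshift n i) => z; rewrite /peval /reval !mevalXU.
  rewrite /real_coord (unsplitK (inl i)) (unsplitK (inr i)).
  by case: (z ord0 i).
- exists (P + P'), (Q + Q') => z.
  by rewrite /peval mevalD -!/(peval _ _) E E' /reval !mevalD.
- exists (P * P' - Q * Q'), (P * Q' + Q * P') => z.
  by rewrite /peval mevalM -!/(peval _ _) E E' /reval mevalB mevalD !mevalM.
Qed.

Definition sqmods (s : seq (cpoly R n)) z : R := \sum_(h <- s) sqmod (peval h z).

Lemma sqmods_ge0 s z : 0 <= sqmods s z.
Proof. by apply: sumr_ge0 => h _; exact: sqmod_ge0. Qed.

(* The good polynomials of the header. *)
Definition dominates_squares P := exists s, forall z, sqlen z <= 1 ->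
  sqmods s z <= reval P z /\ (sqlen z = 1 -> sqmods s z = reval P z).

Lemma dominates_squaresD P Q : dominates_squares P -> dominates_squares Q ->
  dominates_squares (P + Q).
Proof.
move=> [s sP] [t tQ]; exists (s ++ t) => z z1.
have [? eP] := sP z z1; have [? eQ] := tQ z z1.
rewrite /sqmods big_cat -!/(sqmods _ _)/= /reval mevalD -!/(reval _ _).
by split=> [|z1']; [exact: lerD|rewrite eP ?eQ].
Qed.

Lemma dominates_squaresM P Q : dominates_squares P -> dominates_squares Q ->
  dominates_squares (P * Q).
Proof.
move=> [s sP] [t tQ]; exists [seq g * h | g <- s, h <- t] => z z1.
have [? eP] := sP z z1; have [? eQ] := tQ z z1.
have -> : sqmods [seq g * h | g <- s, h <- t] z = sqmods s z * sqmods t z.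
  rewrite /sqmods big_allpairs_dep big_distrlr/=; apply: eq_bigr => g _; apply: eq_bigr => h _.
  by rewrite /peval mevalM sqmodM.
rewrite /reval mevalM -!/(reval _ _).
by split=> [|z1']; [apply: ler_pM => //; exact: sqmods_ge0|rewrite eP ?eQ].
Qed.

Lemma dominates_squaresC (r : R) : 0 <= r -> dominates_squares r%:MP.
Proof.
move=> r0; exists [:: ((Num.sqrt r)%:C%C : Cplx R)%:MP] => z _.
by rewrite /sqmods big_seq1 /peval /reval !mevalC sqmod_real sqr_sqrtr.
Qed.

Lemma sqmods_vars z : sqmods [seq 'X_i | i <- enum 'I_n] z = sqlen z.
Proof.
by rewrite /sqmods big_map big_enum/=; apply: eq_bigr => i _; rewrite /peval mevalXU.
Qed.

(** Since |w + z_j|^2 = 1 + |z_j|^2 + 2 Re (conj w z_j), the gap between [P] and the squares is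
    exactly 1 - |z|^2: nonnegative on the ball, zero on the sphere. *)
Lemma dominates_squares_affine (w : Cplx R) (j : 'I_n) P : sqmod w = 1 ->
  (forall z, reval P z = 2 + 2 * (complex.Re w * complex.Re (z ord0 j)
                                 + complex.Im w * complex.Im (z ord0 j))) ->
  dominates_squares P.
Proof.
move=> w1 PE; exists ((w%:MP + 'X_j) :: [seq 'X_i | i <- enum 'I_n & i != j]) => z z1.
have -> : sqmods ((w%:MP + 'X_j) :: [seq 'X_i | i <- enum 'I_n & i != j]) z =
    reval P z - (1 - sqlen z).
  rewrite PE /sqmods big_cons big_map big_filter big_enum_cond/=.
  rewrite /peval mevalD mevalC mevalXU sqmodD w1 /sqlen [X in 1 - X](bigD1 j)//=.
  under eq_bigr do rewrite mevalXU.
  by ring.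
by split=> [|->]; lra.
Qed.

Lemma dominates_squares_var l : exists k,
  dominates_squares (k%:MP - 'X_l) /\ dominates_squares (k%:MP + 'X_l).
Proof.
have half P : dominates_squares (2%:MP * P) -> dominates_squares P.
  move=> /(dominates_squaresM (dominates_squaresC (r := 2^-1) _)).
  by rewrite mulrA -mpolyCM mulVf ?pnatr_eq0// mul1r; apply; rewrite invr_ge0.
(* With z_j = x + iy, the choices w = -1, 1, -i, i give twice 1 - x, 1 + x, 1 - y, 1 + y. *)
exists 1; rewrite -(splitK l); case: (fintype.split l) => j; rewrite /unsplit.
- split; apply: half.
    apply: (@dominates_squares_affine (-1) j); first by rewrite /sqmod/=; ring.
    move=> z; rewrite /reval mevalM mevalB !mevalC mevalXU /real_coord (unsplitK (inl j))/=.
    by ring.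
  apply: (@dominates_squares_affine 1 j); first by rewrite /sqmod/=; ring.
  move=> z; rewrite /reval mevalM mevalD !mevalC mevalXU /real_coord (unsplitK (inl j))/=.
  by ring.
- split; apply: half.
    apply: (@dominates_squares_affine (0 -i* 1)%C j); first by rewrite /sqmod/=; ring.
    move=> z; rewrite /reval mevalM mevalB !mevalC mevalXU /real_coord (unsplitK (inr j))/=.
    by ring.
  apply: (@dominates_squares_affine (0 +i* 1)%C j); first by rewrite /sqmod/=; ring.
  move=> z; rewrite /reval mevalM mevalD !mevalC mevalXU /real_coord (unsplitK (inr j))/=.
  by ring.
Qed.

(** Both signs are carried along because products need them: 2(km - PQ) = (k - P)(m + Q) + (k + P)(m
    - Q), and similarly for km + PQ. *)
Lemma dominates_squares_bound P : exists k,
  dominates_squares (k%:MP - P) /\ dominates_squares (k%:MP + P).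
Proof.
elim/mpoly_ring_ind: P => [a|l|P Q [k [Pk Pk']] [m [Qm Qm']]|P Q [k [Pk Pk']] [m [Qm Qm']]].
- exists `|a|; rewrite -mpolyCB -mpolyCD.
  split; apply: dominates_squaresC; first by rewrite subr_ge0 ler_norm.
  by rewrite -lerBlDl sub0r lerNl -normrN ler_norm.
- exact: dominates_squares_var.
- exists (k + m); rewrite mpolyCD; split.
    have -> : k%:MP + m%:MP - (P + Q) = (k%:MP - P) + (m%:MP - Q) by ring.
    exact: dominates_squaresD.
  have -> : k%:MP + m%:MP + (P + Q) = (k%:MP + P) + (m%:MP + Q) by ring.
  exact: dominates_squaresD.
- have h0 : dominates_squares (2^-1)%:MP by apply: dominates_squaresC; rewrite invr_ge0.
  have hh : (2^-1 : R)%:MP * 2 = 1 :> {mpoly R[n + n]}.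
    by rewrite -(mpolyC_nat _ _ 2) -mpolyCM mulVf ?pnatr_eq0.
  exists (k * m); rewrite mpolyCM; split.
    have -> : k%:MP * m%:MP - P * Q = (2^-1)%:MP *
        ((k%:MP - P) * (m%:MP + Q) + (k%:MP + P) * (m%:MP - Q)).
      rewrite -[LHS]mul1r -hh; ring.
    apply: dominates_squaresM => //.
    by apply: dominates_squaresD; exact: dominates_squaresM.
  have -> : k%:MP * m%:MP + P * Q = (2^-1)%:MP *
      ((k%:MP - P) * (m%:MP - Q) + (k%:MP + P) * (m%:MP + Q)).
    rewrite -[LHS]mul1r -hh; ring.
  apply: dominates_squaresM => //.
  by apply: dominates_squaresD; exact: dominates_squaresM.
Qed.

Lemma dominates_squares_archimedean :
  archimedean_semiring (@mpolyC (n + n) R) dominates_squares.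
Proof.
split; [exact: dominates_squaresC|exact: dominates_squaresD|exact: dominates_squaresM|].
by move=> P; have [k []] := dominates_squares_bound P; exists k.
Qed.

Lemma reval_sqlen z :
  reval (\sum_(j < n) ('X_(lshift n j) ^+ 2 + 'X_(rshift n j) ^+ 2)) z = sqlen z.
Proof.
rewrite /reval raddf_sum; apply: eq_bigr => j _ /=.
rewrite mevalD !rmorphXn/= !mevalXU.
by rewrite /real_coord (unsplitK (inl j)) (unsplitK (inr j)).
Qed.

Lemma dominates_squares_ball :
  dominates_squares (1 - \sum_(j < n) ('X_(lshift n j) ^+ 2 + 'X_(rshift n j) ^+ 2)).
Proof.
exists [::] => z z1; rewrite /sqmods big_nil /reval mevalB meval1 -/(reval _ _) reval_sqlen.
by rewrite subr_ge0; split=> // ->; rewrite subrr.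
Qed.

Lemma character_meval (chi : {mpoly R[n + n]} -> R) :
  {morph chi : P Q / P + Q} -> {morph chi : P Q / P * Q} ->
  (forall r, chi r%:MP = r) -> forall P, chi P = P.@[fun l => chi 'X_l].
Proof.
move=> chiD chiM chiC; elim/mpoly_ring_ind => [r|l|P Q EP EQ|P Q EP EQ].
- by rewrite chiC mevalC.
- by rewrite mevalXU.
- by rewrite chiD mevalD EP EQ.
- by rewrite chiM mevalM EP EQ.
Qed.

Lemma sqmod_sub_dominates (q : cpoly R n) :
  (forall z, closed_unit_ball z -> peval q z != 0) ->
  exists2 e, 0 < e & exists s, forall z, sqlen z <= 1 ->
    sqmods s z <= sqmod (peval q z) - e /\
    (sqlen z = 1 -> sqmods s z = sqmod (peval q z) - e).
Proof.
move=> q0; have [P [Q qE]] := cpoly_re_im q.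
have PQE z : reval (P ^+ 2 + Q ^+ 2) z = sqmod (peval q z).
  by rewrite qE /reval mevalD !rmorphXn.
have [chi chiD chiM chiC chiT|e e0 [s sP]] :=
  kadison_dubois dominates_squares_archimedean (f := P ^+ 2 + Q ^+ 2); last first.
  by exists e => //; exists s => z /sP; rewrite /reval mevalB mevalC -/(reval _ _) PQE.
(* The character is evaluation at this point, and goodness of 1 - |z|^2 puts it in the closed ball,
   where [q] has no zero. *)
pose z := point_of (fun l => chi 'X_l).
have chiE F : chi F = reval F z.
  by rewrite (character_meval chiD chiM chiC) /reval; apply: meval_eq => l; rewrite point_ofK.
rewrite chiE PQE lt_neqAle sqmod_ge0 andbT eq_sym sqmod_eq0.
apply: q0; apply/closed_unit_ball_sqlen.
have := chiT _ dominates_squares_ball.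
by rewrite chiE /reval mevalB meval1 -/(reval _ _) reval_sqlen subr_ge0.
Qed.

End BallPositivity.

(** * Topology of the balls and a criterion for properness *)

Section BallTopology.
Context {R : realType} {n : nat}.

Lemma normcE (x : Cplx R) : `|x| = (Num.sqrt (sqmod x))%:C%C.
Proof. exact: normc_def. Qed.

(** Such a map is 1-Lipschitz; real and imaginary parts are the two instances. *)
Lemma continuous_complex_part (part : Cplx R -> R) :
  (forall x y, part x - part y = part (x - y)) ->
  (forall x, `|part x| <= Num.sqrt (sqmod x)) -> continuous part.
Proof.
move=> partB part_le x; apply/(@cvgrPdist_le _ _ _ (nbhs x)) => e e0.
have e0' : 0 < (e%:C%C : Cplx R) by rewrite -(rmorph0 (real_complex R)) ltcR.
have := nbhsx_ballx x _ e0'; apply: filterS => y; rewrite -ball_normE/= normcE ltcR partB.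
by move=> xy; apply: le_trans (part_le _) (ltW xy).
Qed.

Lemma continuous_Re : continuous (@complex.Re R : Cplx R -> R).
Proof.
apply: continuous_complex_part => [[a b] [u v]|[a b]] //.
by rewrite -sqrtr_sqr /sqmod/= ler_wsqrtr// lerDl sqr_ge0.
Qed.

Lemma continuous_Im : continuous (@complex.Im R : Cplx R -> R).
Proof.
apply: continuous_complex_part => [[a b] [u v]|[a b]] //.
by rewrite -sqrtr_sqr /sqmod/= ler_wsqrtr// lerDr sqr_ge0.
Qed.

Lemma continuous_real_complex : continuous (real_complex R : R -> Cplx R).
Proof.
move=> r; apply/(@cvgrPdist_lt _ _ _ (nbhs r)) => e e0.
have eE : e = (complex.Re e)%:C%C by case: e e0 => a b; rewrite ltcE/= => /andP[/eqP ->].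
have e0' : 0 < complex.Re e by move: e0; rewrite {1}eE -(rmorph0 (real_complex R)) ltcR.
have := nbhsx_ballx r _ e0'; apply: filterS => s; rewrite -ball_normE/= => rs.
by rewrite -rmorphB/= normcE sqmod_real sqrtr_sqr eE ltcR.
Qed.

(** A square around the disc suffices, because the ball is later cut out as a closed subset of a
    product of such squares. *)
Lemma compact_complex_disc : exists2 D : set (Cplx R), compact D &
  forall x, sqmod x <= 1 -> D x.
Proof.
pose f (u : R * R) : Cplx R := real_complex R u.1 + 'i%C * real_complex R u.2.
have coordC (g : R * R -> R) : continuous g ->
    continuous (fun u => real_complex R (g u) : Cplx R).
  move=> gc u.
  apply: (@continuous_comp _ _ _ g (real_complex R : R -> Cplx R)); first exact: gc.
  exact: continuous_real_complex.
exists (f @` (`[-1, 1] `*` `[-1, 1])).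
  apply: continuous_compact; last by apply: compact_setX; exact: segment_compact.
  apply: continuous_subspaceT => u; apply: (@cvgD _ (Cplx R)).
    by apply: (coordC fst) => w; exact: cvg_fst.
  apply: (@cvgM (Cplx R)); first exact: cvg_cst.
  by apply: (coordC snd) => w; exact: cvg_snd.
move=> [a b]; rewrite /sqmod/= => ab; exists (a, b); last exact: (esym (complexE (a +i* b)%C)).
have := sqr_ge0 a; have := sqr_ge0 b.
by split; rewrite /= in_itv/= -ler_norml -(@ler_pXn2r _ 2)// ?nnegrE//
  real_normK ?num_real// expr1n; lra.
Qed.

Lemma continuous_sqlen : continuous (@sqlen R n).
Proof.
move=> z.
have sq (g : Cplx R -> R) i : continuous g ->
    (fun w : 'rV[Cplx R]_n => g (w ord0 i) ^+ 2) @ z --> g (z ord0 i) ^+ 2.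
  move=> gc; have gz : (fun w : 'rV[Cplx R]_n => g (w ord0 i)) @ z --> g (z ord0 i).
    apply: (@continuous_comp _ _ _ (fun w : 'rV[Cplx R]_n => w ord0 i) g); last exact: gc.
    exact: coord_continuous.
  exact: (cvgM gz gz).
have sqmodC i : (fun w : 'rV[Cplx R]_n => sqmod (w ord0 i)) @ z --> sqmod (z ord0 i).
  exact: (cvgD (sq _ i continuous_Re) (sq _ i continuous_Im)).
exact: (@cvg_big R _ +%R 0 xpredT (@add_continuous _) _ (nbhs z) (index_enum _)
  (fun i w => sqmod (w ord0 i)) _ _ (fun i _ => sqmodC i)).
Qed.

Lemma closed_closed_unit_ball : closed (@closed_unit_ball R n).
Proof.
rewrite (_ : closed_unit_ball (n := n) = (@sqlen R n) @^-1` [set x | x <= 1]); last first.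
  by apply/seteqP; split=> z /closed_unit_ball_sqlen.
apply: preimage_closed; [by move=> z _; exact: continuous_sqlen|exact: closed_le].
Qed.

Lemma compact_closed_unit_ball : compact (@closed_unit_ball R n).
Proof.
have [D Dc D1] := compact_complex_disc.
apply: (subclosed_compact closed_closed_unit_ball (rV_compact (fun=> Dc))).
move=> z /closed_unit_ball_sqlen z1 i; apply: D1; apply: le_trans z1.
by rewrite /sqlen (bigD1 i)//= lerDl; apply: sumr_ge0 => j _; exact: sqmod_ge0.
Qed.

Lemma continuous_peval (p : cpoly R n) : continuous (peval p).
Proof.
elim/mpoly_ring_ind: p => [a|i|p q cp cq|p q cp cq] z.
- rewrite (_ : peval _ = cst a); first exact: cst_continuous.
  by apply/funext => w; rewrite /peval mevalC.
- rewrite (_ : peval _ = fun w => w ord0 i); first exact: coord_continuous.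
  by apply/funext => w; rewrite /peval mevalXU.
- rewrite (_ : peval _ = peval p \+ peval q); first exact: cvgD (cp z) (cq z).
  by apply/funext => w; rewrite /peval mevalD.
- rewrite (_ : peval _ = peval p \* peval q); first exact: cvgM (cp z) (cq z).
  by apply/funext => w; rewrite /peval mevalM.
Qed.

Lemma continuous_ratmap N (p : 'I_N -> cpoly R n) (q : cpoly R n) z :
  peval q z != 0 -> {for z, continuous (ratmap p q)}.
Proof.
move=> qz U [P Pz PU].
(* A neighbourhood of a row contains a product of neighbourhoods [P i j] of its entries, so finitely
   many entrywise conditions remain. *)
have : \forall w \near z, forall ij : 'I_1 * 'I_N, P ij.1 ij.2 (ratmap p q w ij.1 ij.2).
  apply: (@filter_forall _ _ _ (nbhs z)) => -[i j]/=.
  have qc : (fun w => peval (p j) w / peval q w) @ z --> peval (p j) z / peval q z.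
    exact: (cvgM (@continuous_peval (p j) z) (cvgV qz (@continuous_peval q z))).
  have := Pz i j; rewrite /ratmap mxE => /qc.
  by apply: (@filterS _ (nbhs z)) => w; rewrite mxE.
by apply: (@filterS _ (nbhs z)) => w Pw; apply: PU => i j; exact: (Pw (i, j)).
Qed.

(** The preimage of [K] lies in the compact closed ball, so it is enough that it be closed. A limit
    point z stays in the closed ball, where the map is continuous, so its image is in [K]; as [K]
    avoids the unit sphere, z is not on the sphere. *)
Lemma sphere_map_proper N (p : 'I_N -> cpoly R n) (q : cpoly R n) :
  (forall z, closed_unit_ball z -> peval q z != 0) ->
  maps_ball (ratmap p q) ->
  (forall z, sqlen z = 1 -> sqlen (ratmap p q z) = 1) ->
  proper_ball_map (ratmap p q).
Proof.
move=> q0 fB fS; split=> // K KB Kc.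
have Kcl : closed K := compact_closed (@norm_hausdorff _ _) Kc.
apply: (subclosed_compact _ compact_closed_unit_ball); last first.
  by move=> z [/unit_ball_sqlen zB _]; apply/closed_unit_ball_sqlen; exact: ltW.
move=> z Sz.
have zB : closed_unit_ball z.
  apply: closed_closed_unit_ball => U /Sz[w [[/unit_ball_sqlen wB _] Uw]].
  by exists w; split=> //; apply/closed_unit_ball_sqlen; exact: ltW.
have Kz : K (ratmap p q z).
  apply: Kcl => U /(continuous_ratmap (q0 _ zB)) /Sz[w [[_ Kw] Uw]].
  by exists (ratmap p q w).
split=> //; apply/unit_ball_sqlen; rewrite lt_neqAle.
move/closed_unit_ball_sqlen: zB => ->; rewrite andbT.
by apply/eqP => /fS fz; have /unit_ball_sqlen := KB _ Kz; rewrite fz ltxx.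
Qed.

End BallTopology.

(** * Numerators given by lists, lowest terms, and the construction of the map *)

Lemma sqlen_ratmap_nth (R : realType) (n : nat) (s : seq (cpoly R n)) (q : cpoly R n) z :
  sqlen (ratmap (fun j : 'I_(size s) => nth 0 s j) q z) = sqmods s z / sqmod (peval q z).
Proof.
(* At a zero of [q] both sides are 0, since the inverse of 0 is 0 by convention. *)
have [qz|qz] := eqVneq (peval q z) 0.
  rewrite qz (_ : sqmod 0 = 0); last by rewrite /sqmod/=; ring.
  rewrite invr0 mulr0 /sqlen big1// => j _.
  by rewrite /ratmap mxE qz invr0 mulr0 /sqmod/=; ring.
have q20 : sqmod (peval q z) != 0 by rewrite sqmod_eq0.
apply: (mulIf q20); rewrite divfK// /sqmods (big_nth 0) big_mkord mulr_suml.
by apply: eq_bigr => j _; rewrite /ratmap mxE -sqmodM divfK.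
Qed.

(** Degrees add, so the cofactor of [d] in a X_i is a nonzero constant. Hence [d] vanishes at 0, and
    so does its multiple [q]. *)
Lemma nonconstant_divisor_var_eval0 (R : realType) (n : nat) (a : Cplx R) (i : 'I_n)
    (d q : cpoly R n) :
  a != 0 -> nonconstant d -> pdivides d (a *: 'X_i) -> pdivides d q -> peval q 0 = 0.
Proof.
move=> a0 dn [r aE] [u ->].
have aX0 : a *: 'X_i != 0 :> cpoly R n.
  by rewrite -msize_poly_eq0 msizeZ// msizeX mdeg1.
have /andP[d0 r0] : (d != 0) && (r != 0).
  by rewrite -negb_or -mulf_eq0 -aE.
have : msize (a *: 'X_i : cpoly R n) = 2%N by rewrite msizeZ// msizeX mdeg1.
rewrite aE msizeM// => sz.
(* [msize] is the degree plus one: msize d + msize r - 1 = 2 with msize d at least 2 leaves msize r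
   = 1. *)
have /msize_poly1P[b b0 rE] : msize r == 1%N.
  have : (0 < msize r)%N by rewrite lt0n msize_poly_eq0.
  move: dn sz; rewrite /nonconstant; case: (msize d) => [|[|k]]// _.
  case: (msize r) => [|m]//; rewrite !addSn addnS/= => -[/eqP].
  by rewrite addn_eq0 => /andP[_ /eqP->].
have d00 : peval d 0 = 0.
  have : peval (d * r) 0 = 0 by rewrite -aE /peval mevalZ mevalXU mxE mulr0.
  rewrite /peval mevalM rE mevalC => /eqP.
  by rewrite mulf_eq0 (negbTE b0) orbF => /eqP.
by rewrite /peval mevalM -/(peval d _) d00 mul0r.
Qed.

Lemma mpoly0_constant (K : comNzRingType) (n : nat) (p : {mpoly K[n]}) :
  n = 0%N -> exists a, p = a%:MP.
Proof.
move=> n0; elim/mpoly_ring_ind: p => [a|i|_ _ [a ->] [b ->]|_ _ [a ->] [b ->]].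
- by exists a.
- by have := ltn_ord i; rewrite [X in (_ < X)%N]n0.
- by exists (a + b); rewrite mpolyCD.
- by exists (a * b); rewrite mpolyCM.
Qed.

Theorem theorem6p1 (R : realType) (n : nat) (q : cpoly R n) :
  (forall z, @closed_unit_ball R n z -> peval q z != 0) ->
  exists (N : nat) (p : 'I_N -> cpoly R n),
    proper_ball_map (ratmap p q) /\ reduced p q.
Proof.
move=> q0; have [n0|] := posnP n.
  (* Without variables the map to C^0 works: the unit sphere is empty and every polynomial is
     constant. *)
  exists 0%N, (fun _ => 0); split.
    apply: sphere_map_proper => // z.
      by move=> _; apply/unit_ball_sqlen; rewrite /sqlen big_ord0.
    rewrite /sqlen big1 => [|i _]; first by move/eqP; rewrite eq_sym oner_eq0.
    by have := ltn_ord i; rewrite [X in (_ < X)%N]n0.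
  move=> d; have [a ->] := mpoly0_constant d n0.
  by rewrite /nonconstant msizeC; case: (a != 0).
move=> n_gt0; have [e e0 [s sE]] := sqmod_sub_dominates q0.
pose a : Cplx R := (Num.sqrt e)%:C%C.
have sqmod_a : sqmod a = e by rewrite sqmod_real sqr_sqrtr// ltW.
(* The added components contribute e |z|^2, which restores |q|^2 on the sphere and keeps the sum
   strictly below it inside. *)
pose t := s ++ [seq a *: h | h <- [seq 'X_i | i <- enum 'I_n]].
have tE z : sqmods t z = sqmods s z + e * sqlen z.
  rewrite /sqmods big_cat/=; congr (_ + _).
  rewrite -sqmods_vars /sqmods mulr_sumr big_map; apply: eq_bigr => h _.
  by rewrite /peval mevalZ sqmodM sqmod_a.
have q_gt0 z : sqlen z <= 1 -> 0 < sqmod (peval q z).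
  move=> z1; rewrite lt_neqAle sqmod_ge0 andbT eq_sym sqmod_eq0.
  by apply: q0; apply/closed_unit_ball_sqlen.
exists (size t), (fun j => nth 0 t j); split.
  apply: sphere_map_proper => // z.
    move=> /unit_ball_sqlen z1; apply/unit_ball_sqlen.
    have [sle _] := sE _ (ltW z1).
    rewrite sqlen_ratmap_nth ltr_pdivrMr ?q_gt0 ?ltW// mul1r tE.
    have : e * sqlen z < e by rewrite gtr_pMr.
    lra.
  move=> z1; have z1' : sqlen z <= 1 by rewrite z1.
  have [_ /(_ z1) seq] := sE _ z1'.
  by rewrite sqlen_ratmap_nth tE seq z1 mulr1 subrK divff// gt_eqF// q_gt0.
move=> d dn dq dp.
(* As n > 0 there is a variable X_i; a nonconstant common factor of [q] and a X_i would force q(0) =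
   0, but 0 is in the ball. *)
pose i := Ordinal n_gt0.
have /(nth_index 0) aXt : a *: 'X_i \in t.
  by rewrite mem_cat; apply/orP; right; do 2 apply: map_f; rewrite mem_enum.
have it : (index (a *: 'X_i) t < size t)%N.
  by rewrite index_mem mem_cat; apply/orP; right; do 2 apply: map_f; rewrite mem_enum.
have := dp (Ordinal it); rewrite /= aXt => dX.
have a0 : a != 0 by rewrite -sqmod_eq0 sqmod_a gt_eqF.
suff : peval q 0 != 0 by rewrite (nonconstant_divisor_var_eval0 a0 dn dX dq) eqxx.
apply: q0; apply/closed_unit_ball_sqlen.
rewrite /sqlen big1 ?ler01// => j _; by apply/eqP; rewrite mxE sqmod_eq0.
Qed.
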